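(* For every set $X$ that is a proper subset of $\{\text{taco},\text{bat},\text{nested},\text{crossing},\text{ears},\text{swords},\text{david}\}$, $\mathrm{ex}(n,X)\in\Omega(n)$ as $n\to\infty$.
   Context: Let $P$ be a set of $n$ points in convex position in the plane (the vertices of a convex $n$-gon); a triangle on $P$ is a 3-element subset of $P$. For two distinct triangles $t_1,t_2$ on $P$, label each point of $t_1\cup t_2$ by the triangle(s) containing it and read the points in their cyclic order around the polygon. The pair forms exactly one of eight configurations. (i) If $t_1,t_2$ share two vertices $u,v$: ''taco'' if their third vertices lie on the same side of the line $uv$, ''mariposa'' if on opposite sides. (ii) If they share exactly one vertex $v$: read the remaining four vertices in cyclic order starting just after $v$; ''bat'' if the pattern is $t_1t_1t_2t_2$ or $t_2t_2t_1t_1$, ''nested'' if it is $t_1t_2t_2t_1$ or $t_2t_1t_1t_2$, ''crossing'' if it is $t_1t_2t_1t_2$ or $t_2t_1t_2t_1$. (iii) If they share no vertex, the cyclic sequence of the six labels is, up to rotation, reflection and exchanging the roles of $t_1,t_2$, one of: ''ears'' $AAABBB$, ''swords'' $AABABB$, ''david'' $ABABAB$. For a set $X$ of configurations, $\mathrm{ex}(n,X)$ is the maximum size of a family of triangles on $P$ in which no two triangles form a configuration belonging to $X$ (this depends only on $n$ and $X$). *)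

(* Defs.v *)
From HB Require Import structures.
From mathcomp Require Import all_boot all_order all_algebra.
From mathcomp Require Import boolp reals.

Set Implicit Arguments.
Unset Strict Implicit.
Unset Printing Implicit Defensive.

Import Order.TTheory GRing.Theory Num.Theory.
Local Open Scope ring_scope.

Variant config :=
  taco | mariposa | bat | nested | crossing | ears | swords | david.

Definition config_code (c : config) : 'I_8 :=
  match c with
  | taco => inord 0 | mariposa => inord 1 | bat => inord 2
  | nested => inord 3 | crossing => inord 4 | ears => inord 5
  | swords => inord 6 | david => inord 7
  end.

Definition config_decode (i : 'I_8) : config :=
  nth taco [:: taco; mariposa; bat; nested; crossing; ears; swords; david] i.

Lemma config_codeK : cancel config_code config_decode.
Proof. by case; rewrite /config_decode /= inordK. Qed.

HB.instance Definition _ := Finite.copy config (can_type config_codeK).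

Section Configurations.
Variable R : realType.

(* Twice the signed area of the triangle pqr. *)
Definition orient (p q r : 'rV[R]_2) : R :=
  (q 0 0 - p 0 0) * (r 0 1 - p 0 1) - (q 0 1 - p 0 1) * (r 0 0 - p 0 0).

Variables (n : nat) (P : 'I_n -> 'rV[R]_2).

(* No point is a convex combination of the points with the other indices; in
   particular P is injective. The indices carry no geometric meaning: they need
   not follow the order of the points around the polygon. *)
Definition convex_position : Prop :=
  forall i : 'I_n, ~ exists w : 'I_n -> R,
    [/\ forall j, 0 <= w j, w i = 0, \sum_j w j = 1
      & P i = \sum_j w j *: P j].

Definition ccw (i j k : 'I_n) : bool := 0 < orient (P i) (P j) (P k).

(* For points in convex position, being listed in counterclockwise cyclic order
   around the polygon means that every three of them, taken in the order of the
   list, form a counterclockwise triangle. *)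
Fixpoint ccw_seq (s : seq 'I_n) : bool :=
  if s is x :: s' then pairwise (ccw x) s' && ccw_seq s' else true.

Definition reads (t1 t2 : {set 'I_n}) (s : seq 'I_n) : Prop :=
  [/\ uniq s, s =i t1 :|: t2 & ccw_seq s].

(* Only applied to points lying in exactly one of t1 and t2: true stands for
   t1 and false for t2. *)
Definition labels (t1 : {set 'I_n}) (s : seq 'I_n) : seq bool :=
  [seq x \in t1 | x <- s].

Definition share_two (t1 t2 : {set 'I_n}) (side : R -> R -> Prop) : Prop :=
  exists u v w1 w2 : 'I_n,
    [/\ u != v, t1 :&: t2 = [set u; v],
        t1 = [set u; v; w1], t2 = [set u; v; w2]
      & side (orient (P u) (P v) (P w1)) (orient (P u) (P v) (P w2))].

Definition share_one (t1 t2 : {set 'I_n}) (pat : seq bool) : Prop :=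
  exists (v : 'I_n) (s : seq 'I_n),
    [/\ t1 :&: t2 = [set v], reads t1 t2 (v :: s)
      & labels t1 s = pat \/ labels t1 s = map negb pat].

Definition share_none (t1 t2 : {set 'I_n}) (pat : seq bool) : Prop :=
  exists (s : seq 'I_n) (k : nat),
    [/\ t1 :&: t2 = set0, reads t1 t2 s
      & rot k (labels t1 s)
          \in [:: pat; rev pat; map negb pat; map negb (rev pat)]].

Local Notation A := true.
Local Notation B := false.

Definition forms (c : config) (t1 t2 : {set 'I_n}) : Prop :=
  match c with
  | taco => share_two t1 t2 (fun a b => 0 < a * b)
  | mariposa => share_two t1 t2 (fun a b => a * b < 0)
  | bat => share_one t1 t2 [:: A; A; B; B]
  | nested => share_one t1 t2 [:: A; B; B; A]
  | crossing => share_one t1 t2 [:: A; B; A; B]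
  | ears => share_none t1 t2 [:: A; A; A; B; B; B]
  | swords => share_none t1 t2 [:: A; A; B; A; B; B]
  | david => share_none t1 t2 [:: A; B; A; B; A; B]
  end.

Definition free_family (X : {set config}) (F : {set {set 'I_n}}) : Prop :=
  (forall t, t \in F -> #|t| = 3%N) /\
  (forall t1 t2, t1 \in F -> t2 \in F -> t1 != t2 ->
     forall c, c \in X -> ~ forms c t1 t2).

Definition ex_num (X : {set config}) : nat :=
  \max_(F : {set {set 'I_n}} | `[< free_family X F >]) #|F|.

End Configurations.

(* Main.v *)
Require Import Defs.
From mathcomp Require Import all_boot all_order all_algebra.
From mathcomp Require Import boolp classical_sets reals topology normedtype landau.
From mathcomp Require Import zify ring lra.

Set Implicit Arguments.
Unset Strict Implicit.
Unset Printing Implicit Defensive.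

Import Order.TTheory GRing.Theory Num.Theory.
Import numFieldNormedType.Exports.
Local Open Scope ring_scope.

(** In convex position no point lies in the triangle of three others, so around
    each point the counterclockwise relation is a strict total order; sorting
    around one point lists all points as p_0, ..., p_(n-1) in cyclic order.
    Some configuration c other than mariposa is missing from X, and for each c
    there are about n/3 triangles on the p_k any two of which form c.  Since two
    triangles form at most one configuration (up to taco/mariposa), this family
    avoids X.  The configurations are told apart by the number of shared
    vertices, by the labels read from the shared vertex if there is exactly one,
    and by the number of equal cyclic neighbours (4 for ears, 2 for swords, 0
    for david) if there is none. *)

(** * Orientation and cyclic order of points in convex position *)

Section CyclicOrder.
Variables (R : realType) (n : nat) (P : 'I_n -> 'rV[R]_2).
Local Notation o i j k := (orient (P i) (P j) (P k)).

Lemma orient_rot (p q r : 'rV[R]_2) : orient p q r = orient q r p.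
Proof. by rewrite /orient; ring. Qed.

Lemma orient_swap (p q r : 'rV[R]_2) : orient p r q = - orient p q r.
Proof. by rewrite /orient; ring. Qed.

Lemma ccw_rot i j k : ccw P i j k = ccw P j k i.
Proof. by rewrite /ccw orient_rot. Qed.

Lemma ccw_antisym i : antisymmetric (ccw P i).
Proof.
by move=> j k /andP[]; rewrite /ccw orient_swap oppr_gt0 => a /(lt_trans a);
  rewrite ltxx.
Qed.

Hypothesis P_convex : convex_position P.

(** Dividing by [x + y + z] would give a convex combination. The weights are sums of indicators, so
    [a], [b], [c] may coincide; this yields the segment case and injectivity. *)
Lemma convex_position_not_in_triangle (i a b c : 'I_n) (x y z : R) :
    i \notin [:: a; b; c] -> 0 <= x -> 0 <= y -> 0 <= z -> 0 < x + y + z ->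
  (x + y + z) *: P i <> x *: P a + y *: P b + z *: P c.
Proof.
rewrite !inE !negb_or => /and3P[ia ib ic] x0 y0 z0 s0 e.
have d0 : x + y + z != 0 by rewrite gt_eqF.
apply: (P_convex (i := i)).
exists (fun j =>
  (x * (j == a)%:R + y * (j == b)%:R + z * (j == c)%:R) / (x + y + z)).
have sum1 (d : 'I_n) : \sum_j (j == d)%:R = 1 :> R.
  by rewrite (bigD1 d) //= eqxx big1 ?addr0 // => j /negPf ->.
have sumP (d : 'I_n) : \sum_j (j == d)%:R *: P j = P d.
  rewrite (bigD1 d) //= eqxx scale1r big1 ?addr0 // => j /negPf ->.
  by rewrite scale0r.
split.
- move=> j; apply: divr_ge0; last exact: ltW.
  by rewrite !addr_ge0 // mulr_ge0.
- by rewrite (negPf ia) (negPf ib) (negPf ic) !mulr0 !addr0 mul0r.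
- rewrite -mulr_suml !big_split /= -!mulr_sumr !sum1 !mulr1.
  by rewrite divff.
- apply: (scalerI d0); rewrite e scaler_sumr.
  under eq_bigr => j _ do
    rewrite scalerA mulrC divfK // !scalerDl -!scalerA.
  by rewrite !big_split /= -!scaler_sumr !sumP.
Qed.

Lemma rV2P (u v : 'rV[R]_2) : u 0 0 = v 0 0 -> u 0 1 = v 0 1 -> u = v.
Proof.
move=> e0 e1; apply/rowP=> j; case: j => [[|[|//]] lj].
- by rewrite (_ : Ordinal lj = 0) //; apply/val_inj.
- by rewrite (_ : Ordinal lj = 1) //; apply/val_inj.
Qed.

(* Cramer's rule: the barycentric coordinates of the first point are signed
   areas. *)
Lemma orient_barycentric i a b c :
  (o i b c + o i c a + o i a b) *: P i =
  o i b c *: P a + o i c a *: P b + o i a b *: P c.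
Proof. by apply: rV2P; rewrite !mxE /orient; ring. Qed.

Lemma convex_position_not_inside i a b c : i \notin [:: a; b; c] ->
  0 < o i a b -> 0 < o i b c -> 0 < o i c a -> False.
Proof.
move=> iabc ab bc ca.
apply: (convex_position_not_in_triangle iabc (ltW bc) (ltW ca) (ltW ab)).
  exact: addr_gt0 (addr_gt0 bc ca) ab.
exact: orient_barycentric.
Qed.

Lemma convex_position_not_between i a b (x y : R) :
    i != a -> i != b -> 0 <= x -> 0 <= y -> 0 < x + y ->
  (x + y) *: P i <> x *: P a + y *: P b.
Proof.
move=> ia ib x0 y0 s0 e.
have iab : i \notin [:: a; b; b] by rewrite !inE !negb_or ia ib.
apply: (convex_position_not_in_triangle (z := 0) iab x0 y0); rewrite ?addr0 //.
by rewrite e scale0r addr0.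
Qed.

Lemma convex_position_inj : injective P.
Proof.
move=> i j e; apply: contrapT => /eqP ij.
apply: (@convex_position_not_between i j j 1 0) => //; rewrite ?addr0 //.
by rewrite e scale0r addr0.
Qed.

(** On a line, a coordinate [d] that separates [a] from [b] is an affine parameter, so betweenness
    in [d] yields the weights of a convex combination. *)
Lemma orient_eq0_not_between i a b (d : 'I_2) : i != a -> i != b ->
  o i a b = 0 -> P a 0 d <= P i 0 d <= P b 0 d -> P a 0 d < P b 0 d -> False.
Proof.
move=> ia ib e0 /andP[ai ib'] ab.
apply: (@convex_position_not_between i a b (P b 0 d - P i 0 d)
  (P i 0 d - P a 0 d)) => //; rewrite ?subr_ge0 // addrA subrK ?subr_gt0 //.
have dd : d = 0 \/ d = 1.
  by case: d {ai ib' ab} => [[|[|//]] ld]; [left | right]; apply/val_inj.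
by move: e0; rewrite /orient; case: dd => -> e0; apply: rV2P; rewrite !mxE; lra.
Qed.

Lemma orient_neq0 i a b : i != a -> i != b -> a != b -> o i a b != 0.
Proof.
move=> ia ib ab; apply/eqP => e0.
have eai : o a b i = 0 by rewrite -orient_rot.
have ebi : o b i a = 0 by rewrite -orient_rot.
have eia : o i b a = 0 by rewrite orient_swap e0 oppr0.
have eab : o a i b = 0 by rewrite orient_swap eai oppr0.
have eba : o b a i = 0 by rewrite orient_swap ebi oppr0.
(* In a coordinate where [i] and [a] differ, one of the three collinear points lies between the
   other two, and [B1] to [B6] exclude every order. Agreement in both coordinates contradicts
   injectivity. *)
suff key d : P i 0 d = P a 0 d.
  by move/eqP: ia; apply; apply: convex_position_inj; apply: rV2P.
have [ai bi ba] : [/\ a != i, b != i & b != a] by rewrite !(eq_sym b) eq_sym.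
have B1 := @orient_eq0_not_between i a b d ia ib e0.
have B2 := @orient_eq0_not_between i b a d ib ia eia.
have B3 := @orient_eq0_not_between a b i d ab ai eai.
have B4 := @orient_eq0_not_between a i b d ai ab eab.
have B5 := @orient_eq0_not_between b i a d bi ba ebi.
have B6 := @orient_eq0_not_between b a i d ba bi eba.
case: (ltgtP (P i 0 d) (P a 0 d)) => // ltia; exfalso.
- have [lb|lb] := leP (P b 0 d) (P i 0 d); first by apply: B2; lra.
  by have [lb'|lb'] := leP (P b 0 d) (P a 0 d); [apply: B5 | apply: B4]; lra.
- have [lb|lb] := leP (P b 0 d) (P a 0 d); first by apply: B3; lra.
  by have [lb'|lb'] := leP (P b 0 d) (P i 0 d); [apply: B6 | apply: B1]; lra.
Qed.

Lemma ccw_total i a b : i != a -> i != b -> a != b ->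
  ccw P i a b || ccw P i b a.
Proof.
move=> ia ib ab; rewrite /ccw (orient_swap (P i) (P a)) oppr_gt0.
by rewrite orbC -neq_lt orient_neq0.
Qed.

Lemma ccw_irr i a : ccw P i a a = false.
Proof. by rewrite /ccw (_ : o i a a = 0) ?ltxx // /orient; ring. Qed.

Lemma ccw_irrl i a : ccw P i i a = false.
Proof. by rewrite ccw_rot ccw_rot ccw_irr. Qed.

Lemma ccw_irrr i a : ccw P i a i = false.
Proof. by rewrite ccw_rot ccw_irr. Qed.

Lemma ccw_neq i a b : ccw P i a b -> [/\ i != a, i != b & a != b].
Proof.
move=> iab; split; apply: contraTneq iab => ->;
  by rewrite ?ccw_irr ?ccw_irrl ?ccw_irrr.
Qed.

(* Otherwise the apex i would lie inside the triangle abc. *)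
Lemma ccw_trans i : transitive (ccw P i).
Proof.
move=> b a c ab bc; have [ia ib _] := ccw_neq ab; have [_ ic _] := ccw_neq bc.
have [ac|ac] := eqVneq a c.
  by move: (@ccw_antisym i a b); rewrite ab {1}ac bc => /(_ isT) e;
    rewrite -e ccw_irr in ab.
case/orP: (ccw_total ia ic ac) => // ca.
by case: (@convex_position_not_inside i a b c) => //;
  rewrite !inE !negb_or ia ib ic.
Qed.

(* Otherwise b would lie inside the triangle iac. *)
Lemma ccw_tail i a b c : ccw P i a b -> ccw P i b c -> ccw P a b c.
Proof.
move=> ab bc; have ac := ccw_trans ab bc.
have [_ _ nab] := ccw_neq ab; have [ib _ nbc] := ccw_neq bc.
have [_ _ nac] := ccw_neq ac.
case/orP: (ccw_total nab nac nbc) => // acb.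
case: (@convex_position_not_inside b i a c); rewrite ?inE ?negb_or.
- by rewrite (eq_sym b i) ib (eq_sym b a) nab nbc.
- by rewrite orient_rot.
- by rewrite orient_rot.
- by rewrite -orient_rot.
Qed.

(** By [ccw_tail], the order around [v] is also the order around each point of [s] for the points
    after it, so sorting around one vertex suffices. *)
Lemma pairwise_ccw_seq v s : pairwise (ccw P v) s -> ccw_seq P s.
Proof.
elim: s => //= x s IHs /andP[/allP vx vs]; rewrite IHs // andbT.
apply: (sub_in_pairwise (P := mem s)) vs; last by apply/allP.
by move=> y z ys zs; apply: ccw_tail; apply: vx.
Qed.

Lemma ccw_enum (v : 'I_n) :
  exists s, [/\ uniq s, size s = n & ccw_seq P s].
Proof.
pose leT := [rel a b | (a == b) || ccw P v a b].
pose s := sort leT (rem v (enum 'I_n)).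
have us : uniq s by rewrite sort_uniq rem_uniq ?enum_uniq.
have vs : v \notin s by rewrite mem_sort mem_rem_uniq ?enum_uniq // !inE eqxx.
exists (v :: s); split => /=.
- by rewrite vs.
- rewrite size_sort size_rem ?mem_enum // size_enum_ord prednK //.
  exact: leq_ltn_trans (ltn_ord v).
(* The order around [v] does not compare [v] with other points, so [v] is left out of the sort and
   put in front afterwards. *)
have leT_total : {in predC1 v &, total leT}.
  move=> a b; rewrite !inE !(eq_sym _ v) => va vb /=.
  by have [//|ab] := eqVneq a b; rewrite /= ccw_total.
have leT_tr : transitive leT.
  move=> b a c /= /predU1P[-> //|ab] /predU1P[<-|bc]; rewrite ?ab ?orbT //.
  by rewrite (ccw_trans ab bc) orbT.
have pv : pairwise (ccw P v) s.
  have : pairwise [rel a b | leT a b && (a != b)] s.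
    rewrite pairwise_relI -uniq_pairwise us andbT -sorted_pairwise //.
    apply: (sort_sorted_in leT_total); apply/allP => a.
    by rewrite mem_rem_uniq ?enum_uniq // !inE => /andP[].
  by apply: sub_pairwise => a b /= /andP[/orP[->|]].
by rewrite pv (pairwise_ccw_seq pv).
Qed.

Lemma ccw_seq_nth x0 s i j k : ccw_seq P s ->
  (i < j)%N -> (j < k)%N -> (k < size s)%N ->
  ccw P (nth x0 s i) (nth x0 s j) (nth x0 s k).
Proof.
elim: s i j k => // x s IHs i j k /= /andP[xs cs].
case: i j k => [|i] [|j] [|k] //= ij jk ks; last exact: IHs.
by move/pairwiseP: xs => /(_ x0); apply; rewrite ?inE; lia.
Qed.

Lemma ccw_seq_rot k s : ccw_seq P s -> ccw_seq P (rot k s).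
Proof.
(* Moving the head [x] to the end turns triples [x, y, z] into [y, z, x], which have the same
   orientation. *)
have rot1P t : ccw_seq P t -> ccw_seq P (rot 1 t).
  case: t => //= x t; rewrite rot1_cons => /andP[xt ct].
  elim: t xt ct => //= y t IHt /andP[/allP xy xt] /andP[yt ct].
  rewrite IHt // andbT pairwise_rcons yt andbT; apply/allP => z zt.
  by rewrite -ccw_rot xy.
move=> cs; have [ks|ks] := leqP k (size s); last first.
  by rewrite rot_oversize // ltnW.
elim: k ks => [|k IHk] ks; first by rewrite rot0.
by rewrite rotS // rot1P // IHk // ltnW.
Qed.

Lemma ccw_seq_cons_inj x s1 s2 : ccw_seq P (x :: s1) -> ccw_seq P (x :: s2) ->
  perm_eq s1 s2 -> s1 = s2.
Proof.
move=> /= /andP[? _] /andP[? _].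
by apply: pairwise_eq; first exact: ccw_antisym.
Qed.

(** Once [s1] is rotated to start at the head of [s2], both tails are sorted by the same
    antisymmetric relation, hence equal. *)
Lemma ccw_seq_unique s1 s2 : uniq s1 -> uniq s2 -> s1 =i s2 ->
  ccw_seq P s1 -> ccw_seq P s2 -> exists k, s2 = rot k s1.
Proof.
case: s2 => [|x s2] u1 u2 e c1 c2.
  by exists 0%N; rewrite rot0; apply/esym/size0nil/eqP;
    rewrite (perm_size (uniq_perm u1 u2 e)).
have xs1 : x \in s1 by rewrite e mem_head.
have [k t e1] := rot_to xs1; exists k; rewrite e1; congr cons.
apply/esym/(@ccw_seq_cons_inj x); rewrite // -?e1 ?ccw_seq_rot //.
rewrite -(perm_cons x) -e1 perm_rot; exact: uniq_perm.
Qed.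
End CyclicOrder.

(** * A rotation invariant of label sequences *)

Definition cyclic_equal_neighbours (l : seq bool) : nat :=
  count (fun z => z.1 == z.2) (zip l (rot 1 l)).

Lemma cyclic_equal_neighbours_rot k l :
  cyclic_equal_neighbours (rot k l) = cyclic_equal_neighbours l.
Proof.
have zip_rot (l1 l2 : seq bool) : size l1 = size l2 ->
    zip (rot k l1) (rot k l2) = rot k (zip l1 l2).
  move=> e; have [lk|lk] := leqP (size l1) k.
    by rewrite !rot_oversize // ?size_zip -?e ?minnn.
  have st : size (zip (take k l1) (take k l2)) = k.
    by rewrite size_zip !size_takel -?e ?minnn // ltnW.
  rewrite /rot zip_cat ?size_drop ?e // -[in RHS](cat_take_drop k l1).
  rewrite -[in RHS](cat_take_drop k l2) zip_cat ?size_takel -?e // 1?ltnW //.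
  by rewrite drop_size_cat // take_size_cat.
(* Rotations commute, so the zipped list is itself rotated, and [count] ignores order. *)
rewrite /cyclic_equal_neighbours rot_rot zip_rot ?size_rot //.
by apply/permP; rewrite perm_rot.
Qed.

(** * Mutual exclusion of the configurations *)

Section Exclusivity.
Variables (R : realType) (n : nat) (P : 'I_n -> 'rV[R]_2).
Implicit Types (t : {set 'I_n}) (c : config).

(** The intersection determines [v], and the order around [v] determines [s]; only the choice
    between a pattern and its negation remains. *)
Lemma share_one_unique t1 t2 pat pat' :
  share_one P t1 t2 pat -> share_one P t1 t2 pat' ->
  pat = pat' \/ pat = map negb pat'.
Proof.
move=> [v [s [I [u e c] l]]] [v' [s' [I' [u' e' c'] l']]].
have vv : v = v' by apply/finset.set1P; rewrite -I' I finset.set11.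
rewrite -{v'}vv in u' e' c' {I'}.
have ss : s = s'.
  apply: (ccw_seq_cons_inj c c'); rewrite -(perm_cons v).
  by apply: uniq_perm => // x; rewrite e e'.
rewrite -{s'}ss in l' {u' e' c'}.
have nK : involutive (map negb) by move=> z; rewrite mapK //; exact: negbK.
case: l l' => -> [] e0; [by left | by right | right | left].
- by rewrite -e0 nK.
- by rewrite -(nK pat) e0 nK.
Qed.

(** All readings are rotations of one another, so the count does not depend on the reading. The last
    hypothesis holds by evaluation for each concrete pattern. *)
Lemma share_none_neighbours t1 t2 pat s :
  share_none P t1 t2 pat -> reads P t1 t2 s ->
  all (fun z => cyclic_equal_neighbours z == cyclic_equal_neighbours pat)
    [:: pat; rev pat; map negb pat; map negb (rev pat)] ->
  cyclic_equal_neighbours (labels t1 s) = cyclic_equal_neighbours pat.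
Proof.
move=> [s' [k [_ [u' e' c'] l]]] [u e c] /allP inv.
have [m ->] := ccw_seq_unique u' u (fun x => etrans (e' x) (esym (e x))) c' c.
rewrite /labels map_rot cyclic_equal_neighbours_rot.
by rewrite -(cyclic_equal_neighbours_rot k); apply/eqP/inv.
Qed.

Lemma share_two_card t1 t2 side : share_two P t1 t2 side -> #|t1 :&: t2| = 2%N.
Proof. by case=> u [v [w1 [w2 [uv -> _ _ _]]]]; rewrite cards2 uv. Qed.

Lemma share_one_card t1 t2 pat : share_one P t1 t2 pat -> #|t1 :&: t2| = 1%N.
Proof. by case=> v [s [-> _ _]]; rewrite cards1. Qed.

Lemma share_none_card t1 t2 pat : share_none P t1 t2 pat -> #|t1 :&: t2| = 0%N.
Proof. by case=> s [k [-> _ _]]; rewrite cards0. Qed.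

Definition shared_vertices c : nat :=
  match c with
  | taco | mariposa => 2
  | bat | nested | crossing => 1
  | ears | swords | david => 0
  end.

Lemma forms_card c t1 t2 : forms P c t1 t2 -> #|t1 :&: t2| = shared_vertices c.
Proof.
by case: c => /=; solve [exact: share_two_card | exact: share_one_card
  | exact: share_none_card].
Qed.

Lemma share_none_reads t1 t2 pat :
  share_none P t1 t2 pat -> exists s, reads P t1 t2 s.
Proof. by case=> s [k [_ r _]]; exists s. Qed.

(** The number of shared vertices separates three groups. Without [mariposa], [taco] is alone in its
    group; the other two are settled by [share_one_unique] and by the counts 4, 2, 0. *)
Lemma forms_exclusive c c' t1 t2 : forms P c t1 t2 -> forms P c' t1 t2 ->
  c != mariposa -> c' != mariposa -> c = c'.
Proof.
move=> f f' ncm ncm'.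
have := etrans (esym (forms_card f)) (forms_card f').
case: c c' f f' ncm ncm' => [] [] //= f f' m m' _;
  try solve [by rewrite eqxx in m | by rewrite eqxx in m'
    | by case: (share_one_unique f f')].
all: by have [s r] := share_none_reads f;
  have := etrans (esym (share_none_neighbours f r isT))
    (share_none_neighbours f' r isT).
Qed.

(** Needed because a free family concerns ordered pairs, whereas the constructed triangles are
    compared only for [i < j]. *)
Lemma forms_sym c t1 t2 : forms P c t1 t2 -> forms P c t2 t1.
Proof.
have two side : (forall a b, side a b -> side b a) ->
    share_two P t1 t2 side -> share_two P t2 t1 side.
  move=> ss [u [v [w1 [w2 [uv I e1 e2 sd]]]]].
  by exists u, v, w2, w1; split=> //; [rewrite finset.setIC | exact: ss].
have readsC s : reads P t1 t2 s -> reads P t2 t1 s.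
  by case=> u e cs; split=> // x; rewrite finset.setUC.
(* A point of exactly one triangle changes its label when the triangles are exchanged. *)
have labelsC (s : seq 'I_n) : {subset s <= t1 :|: t2} ->
    {in s, forall x, x \notin t1 :&: t2} ->
    labels t2 s = map negb (labels t1 s).
  move=> sU sI; rewrite /labels -map_comp; apply/eq_in_map => x xs /=.
  by have := sU _ xs; have := sI _ xs; rewrite !inE; do 2!case: (x \in _).
have one pat : share_one P t1 t2 pat -> share_one P t2 t1 pat.
  move=> [v [s [I r l]]]; exists v, s; rewrite finset.setIC.
  split=> //; first exact: readsC.
  have [/= /andP[vs _] e _] := r.
  rewrite labelsC //.
  - case: l => ->; [by right | left].
    by rewrite mapK //; exact: negbK.
  - by move=> x xs; rewrite -e inE xs orbT.
  - by move=> x xs; rewrite I inE; apply: contraNneq vs => <-.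
have none pat : share_none P t1 t2 pat -> share_none P t2 t1 pat.
  move=> [s [k [I r l]]]; exists s, k; rewrite finset.setIC.
  split=> //; first exact: readsC.
  have nK : involutive (map negb) by move=> z; rewrite mapK //; exact: negbK.
  rewrite labelsC //; last 2 first.
  - by move=> x xs; have [_ <- _] := r.
  - by move=> x xs; rewrite I inE.
  rewrite -map_rot; move: l; rewrite !inE.
  by case/or4P=> /eqP ->; rewrite ?nK eqxx ?orbT.
case: c => /=; try solve [exact: one | exact: none].
- by apply: two => a b; rewrite mulrC.
- by apply: two => a b; rewrite mulrC.
Qed.

Lemma leq_ex_num (X : {set config}) c (K : nat) (T : nat -> {set 'I_n}) :
    c != mariposa -> c \notin X -> mariposa \notin X ->
    (forall i, (i < K)%N -> #|T i| = 3%N) ->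
    (forall i j, (i < j)%N -> (j < K)%N -> forms P c (T i) (T j)) ->
  (K <= ex_num P X)%N.
Proof.
move=> cm cX mX T3 Tc.
(* Equal triangles would share three vertices, but every configuration shares at most two. *)
have Tneq i j : (i < j)%N -> (j < K)%N -> T i != T j.
  move=> ij jK; apply/eqP => e; have := forms_card (Tc _ _ ij jK).
  by rewrite e finset.setIid T3 //; case: (c).
have Tinj : injective (fun i : 'I_K => T i).
  move=> i j /eqP e; apply/val_inj => /=.
  case: (ltngtP i j) => // ij; first by rewrite (negPf (Tneq _ _ ij _)) in e.
  by rewrite eq_sym (negPf (Tneq _ _ ij _)) in e.
pose F := [set T (i : 'I_K) | i in [set: 'I_K]].
have <- : #|F| = K by rewrite card_imset // cardsT card_ord.
apply: (leq_bigmax_cond (P := fun F => `[< free_family P X F >])).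
apply/asboolP; split.
  by move=> t /imsetP[i _ ->]; rewrite T3.
move=> t1 t2 /imsetP[i _ ->] /imsetP[j _ ->] ne c' c'X f.
have [cc' c'm] : c != c' /\ c' != mariposa.
  by split; [apply: contraNneq cX => -> | apply: contraNneq mX => <-].
case/eqP: cc'; case: (ltngtP i j) => ij.
- exact: forms_exclusive (Tc _ _ ij _) f cm c'm.
- by apply: forms_exclusive (Tc _ _ ij _) (forms_sym f) cm c'm.
- by rewrite ij eqxx in ne.
Qed.
End Exclusivity.

(* Positions along the counterclockwise enumeration; K is the number of
   triangles.  The value at mariposa is irrelevant. *)
Definition family (K : nat) (c : config) (i : nat) : seq nat :=
  match c with
  | taco | mariposa => [:: 0; 1; i.+2]
  | bat => [:: 0; i.*2.+1; i.*2.+2]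
  | nested => [:: 0; i.+1; K.*2 - i]
  | crossing => [:: 0; i.+1; K + i.+1]
  | ears => [:: 3 * i; (3 * i).+1; (3 * i).+2]
  | swords => [:: i.*2; i.*2.+1; K.*2 + i]
  | david => [:: i; K + i; K.*2 + i]
  end%N.

(** * Reduction of the explicit families to arithmetic on positions *)

Section Families.
Variables (R : realType) (n : nat) (P : 'I_n -> 'rV[R]_2) (p : nat -> 'I_n).
Hypothesis p_inj : {in gtn n &, injective p}.
Hypothesis p_ccw : forall i j k, (i < j)%N -> (j < k)%N -> (k < n)%N ->
  ccw P (p i) (p j) (p k).

Definition points (l : seq nat) : {set 'I_n} := [set x in map p l].

Lemma mem_points l k : all (gtn n) (k :: l) -> (p k \in points l) = (k \in l).
Proof.
move=> /= /andP[kn /allP ln]; rewrite inE; apply/mapP/idP => [[j jl e]|kl].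
  by rewrite (p_inj kn (ln _ jl) e).
by exists k.
Qed.

Lemma card_points l : all (gtn n) l -> uniq l -> #|points l| = size l.
Proof.
move=> /allP ln ul; rewrite cardsE -(size_map p); apply/card_uniqP.
by rewrite map_inj_in_uniq // => i j /ln ? /ln ?; apply: p_inj.
Qed.

Lemma points_setI l1 l2 l : all (gtn n) l1 -> all (gtn n) l2 ->
  (forall k, (k \in l1) && (k \in l2) = (k \in l)) ->
  points l1 :&: points l2 = points l.
Proof.
move=> l1n l2n e; apply/finset.setP => x; rewrite inE.
apply/andP/idP => [[]|].
  rewrite inE => /mapP[k kl1 ->]; rewrite mem_points /= ?l2n ?andbT => [kl2|].
    by rewrite inE map_f // -e kl1.
  exact: (allP l1n).
rewrite inE => /mapP[k]; rewrite -e => /andP[kl1 kl2] ->.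
by rewrite !inE !map_f.
Qed.

Lemma ccw_seq_points l : all (gtn n) l -> sorted ltn l -> ccw_seq P (map p l).
Proof.
rewrite (sorted_pairwise ltn_trans).
elim: l => //= a l IHl /andP[_ ln] /andP[/allP al ll]; rewrite IHl // andbT.
rewrite pairwise_map; apply: (sub_in_pairwise (P := mem l)) ll; last exact/allP.
by move=> b c bl cl bc /=; apply: p_ccw; [exact: al | | exact: (allP ln)].
Qed.

Lemma reads_points l1 l2 l : all (gtn n) l -> sorted ltn l ->
  l =i l1 ++ l2 -> reads P (points l1) (points l2) (map p l).
Proof.
move=> ln sl e; split; last exact: ccw_seq_points.
  rewrite map_inj_in_uniq ?(sorted_uniq ltn_trans ltnn) //.
  by move=> i j /(allP ln) ? /(allP ln) ?; apply: p_inj.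
by move=> x; rewrite !inE -mem_cat -map_cat; exact: eq_mem_map.
Qed.

Lemma labels_points l1 l : all (gtn n) l1 -> all (gtn n) l ->
  labels (points l1) (map p l) = [seq k \in l1 | k <- l].
Proof.
move=> l1n ln; rewrite /labels -map_comp; apply/eq_in_map => k kl /=.
by rewrite mem_points //= l1n andbT; exact: (allP ln).
Qed.

Lemma all_gtn_cat l l1 l2 : l =i l1 ++ l2 -> all (gtn n) l ->
  all (gtn n) l1 && all (gtn n) l2.
Proof. by move=> e; rewrite (eq_all_r e) all_cat. Qed.

(** An increasing list of positions is a counterclockwise reading. It must start at the shared
    vertex, which is why the families with one common vertex use position 0. *)
Lemma share_one_points l1 l2 v l pat : all (gtn n) (v :: l) ->
    sorted ltn (v :: l) -> v :: l =i l1 ++ l2 ->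
    (forall k, (k \in l1) && (k \in l2) = (k \in [:: v])) ->
    [seq k \in l1 | k <- l] = pat ->
  share_one P (points l1) (points l2) pat.
Proof.
move=> ln sl e I <-; have /andP[l1n l2n] := all_gtn_cat e ln.
exists (p v), (map p l); split; last 2 first.
- by rewrite -map_cons; exact: reads_points.
- by left; rewrite labels_points //; case/andP: ln.
by rewrite (points_setI l1n l2n I); apply/finset.setP=> x; rewrite !inE.
Qed.

Lemma share_none_points l1 l2 l k pat : all (gtn n) l ->
    sorted ltn l -> l =i l1 ++ l2 ->
    (forall k, (k \in l1) && (k \in l2) = false) ->
    rot k [seq k \in l1 | k <- l]
       \in [:: pat; rev pat; map negb pat; map negb (rev pat)] ->
  share_none P (points l1) (points l2) pat.
Proof.
move=> ln sl e I pk; have /andP[l1n l2n] := all_gtn_cat e ln.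
exists (map p l), k; split; last 2 first.
- exact: reads_points.
- by rewrite labels_points.
by rewrite (@points_setI l1 l2 [::]).
Qed.

Ltac indices := solve [ by rewrite /=; lia | by move=> x; rewrite !inE; lia ].
Ltac pattern_eq := rewrite /= !inE; do ?[congr cons]; lia.

Lemma forms_taco K i j : (3 * K < n)%N -> (i < j < K)%N ->
  forms P taco (points (family K taco i)) (points (family K taco j)).
Proof.
move=> Kn /andP[ij jK].
exists (p 0%N), (p 1%N), (p i.+2), (p j.+2); split.
- by case: (@ccw_neq _ _ P (p 0%N) (p 1%N) (p i.+2)) => //; apply: p_ccw; lia.
- rewrite (@points_setI _ _ [:: 0; 1]%N); [ | indices .. ].
  by apply/finset.setP => x; rewrite !inE.
- by apply/finset.setP => x; rewrite !inE -orbA.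
- by apply/finset.setP => x; rewrite !inE -orbA.
(* Positions 0 and 1 precede both third vertices, so both areas are positive. *)
- by apply: mulr_gt0; apply: p_ccw; lia.
Qed.

Lemma forms_family K c i j : (3 * K < n)%N -> (i < j < K)%N -> c != mariposa ->
  forms P c (points (family K c i)) (points (family K c j)).
Proof.
move=> Kn ijK cm; case: c cm => cm; first exact: forms_taco.
- by rewrite eqxx in cm.
- by apply: (@share_one_points _ _ 0%N [:: i.*2.+1; i.*2.+2; j.*2.+1; j.*2.+2]);
    [indices .. | pattern_eq].
(* The last vertex moves down as the index grows, so the pair of [j] sits inside that of [i]. *)
- by apply: (@share_one_points _ _ 0%N [:: i.+1; j.+1; K.*2 - j; K.*2 - i]%N);
    [indices .. | pattern_eq].
- by apply: (@share_one_points _ _ 0%N [:: i.+1; j.+1; K + i.+1; K + j.+1]%N);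
    [indices .. | pattern_eq].
- apply: (@share_none_points _ _ [:: 3 * i; (3 * i).+1; (3 * i).+2;
    3 * j; (3 * j).+1; (3 * j).+2]%N 0%N); [indices .. |].
  rewrite [map _ _](_ : _ = [:: true; true; true; false; false; false]) //.
  by pattern_eq.
(* The labels read AABBAB; rotating by 2 gives BBABAA, the reversal of the pattern AABABB. *)
- apply: (@share_none_points _ _ [:: i.*2; i.*2.+1; j.*2; j.*2.+1;
    K.*2 + i; K.*2 + j]%N 2%N); [indices .. |].
  rewrite [map _ _](_ : _ = [:: true; true; false; false; true; false]) //.
  by pattern_eq.
- apply: (@share_none_points _ _ [:: i; j; K + i; K + j;
    K.*2 + i; K.*2 + j]%N 0%N); [indices .. |].
  rewrite [map _ _](_ : _ = [:: true; false; true; false; true; false]) //.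
  by pattern_eq.
Qed.

Lemma card_family K c i : (3 * K < n)%N -> (i < K)%N ->
  #|points (family K c i)| = 3%N.
Proof.
by move=> Kn iK; rewrite card_points; case: c; rewrite //= ?inE; lia.
Qed.
End Families.

(** * The linear lower bound *)

Lemma ex_num_lower_bound (R : realType) n (P : 'I_n -> 'rV[R]_2)
    (X : {set config}) c K :
  convex_position P -> c != mariposa -> c \notin X -> mariposa \notin X ->
  (3 * K < n)%N -> (K <= ex_num P X)%N.
Proof.
move=> P_convex cm cX mX Kn.
(* [v] serves both as the point to sort around and as the default value of [nth]. *)
have v : 'I_n by apply: (@Ordinal n 0); lia.
have [s [us sz cs]] := ccw_enum P_convex v.
have p_inj : {in gtn n &, injective (nth v s)}.
  by move=> i j ni nj /eqP; rewrite nth_uniq ?sz // => /eqP.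
have p_ccw i j k : (i < j)%N -> (j < k)%N -> (k < n)%N ->
    ccw P (nth v s i) (nth v s j) (nth v s k).
  by move=> ij jk kn; apply: ccw_seq_nth; rewrite ?sz.
apply: (@leq_ex_num _ _ P X c K
  (fun i => points (nth v s) (family K c i))) => //.
- by move=> i iK; apply: card_family.
- by move=> i j ij jK; apply: forms_family => //; rewrite ij.
Qed.

Theorem theorem3 (R : realType) (P : forall n : nat, 'I_n -> 'rV[R]_2)
    (P_convex : forall n : nat, convex_position (P n)) (X : {set config})
    (X_proper : X \proper
       [set taco; bat; nested; crossing; ears; swords; david]%SET) :
  (fun n : nat => (ex_num (P n) X)%:R : R) \is
    'Omega_(\oo%classic) (fun n : nat => n%:R : R).
Proof.
have /properP[/fintype.subsetP sX [c cin cX]] := X_proper.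
have mN : mariposa \notin
    [set taco; bat; nested; crossing; ears; swords; david]%SET.
  rewrite !inE; do ?[apply/norP; split];
    by apply/eqP => /(congr1 (fun c => if c is mariposa then true else false)).
have cm : c != mariposa by apply: contraNneq mN => <-.
have mX : mariposa \notin X by apply: contra mN; exact: sX.
(* For [n >= 6], the integer part of [(n - 1) / 3] is at least [n / 3 - 1], hence at least
   [n / 6]. *)
rewrite qualifE; apply/asboolP; exists 6^-1; first by rewrite invr_gt0.
exists 6%N => // n /= n6; rewrite !ger0_norm //.
rewrite mulrC ler_pdivrMr // -natrM ler_nat.
(* [n.-1 %/ 3] is the largest [K] with [3 * K < n]. *)
have : (n.-1 %/ 3 <= ex_num (P n) X)%N.
  by apply: (@ex_num_lower_bound _ _ _ _ c) => //; lia.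
lia.
Qed.
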